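(* For each $q\in\mathbb R$ there exists a unique smooth function $v_q:(0,\infty)\to\mathbb R$ such that $V=2v_q$ satisfies $$r^2V''+rV'=\sin V,$$ with $v_q(0+)=0$ and $v_q'(0+)=q$. For $p,q\in\mathbb R$ define on $\mathbb R^3\smallsetminus L$ the unit vector field $$\sigma_{p,q}=\cos(\theta+p)\sin v_q(r)\,\xi_1+\sin(\theta+p)\sin v_q(r)\,\xi_2+\cos v_q(r)\,\xi_3 .$$ Then, for all $p,q\in\mathbb R$: (a) $\sigma_{p,q}$, regarded as a map to $S^2$, extends to a continuous map $\mathbb R^3\to S^2$ (with value $\xi_3$ on $L$) and is a harmonic map on $\mathbb R^3\smallsetminus L$; (b) the energy density (equivalently, the bending $|\nabla\sigma_{p,q}|^2$) extends from $\mathbb R^3\smallsetminus L$ to a bounded continuous function on $\mathbb R^3$; (c) $\sigma_{p+\pi,q}=\sigma_{p,-q}$, so that the family is parametrized by an open Möbius band, namely the quotient of $\mathbb R^2$ by the group generated by $(p,q)\mapsto(p+\pi,-q)$.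
   Context: $(\xi_1,\xi_2,\xi_3)$ is a right-handed orthonormal basis of $\mathbb R^3$, $L$ is the line through the origin generated by $\xi_3$, and $(r,\theta,z)$ are the corresponding cylindrical polar coordinates, so $r$ is the distance to $L$. The notation $f(0+)$ means $\lim_{r\to0^+}f(r)$. A smooth unit vector field $\sigma$ on a domain of $\mathbb R^3$ is harmonic if $\nabla^*\nabla\sigma=|\nabla\sigma|^2\sigma$, where $\nabla^*\nabla=-\mathrm{Tr}\,\nabla^2$; this is equivalent to $\sigma$, viewed as a map into the unit sphere $S^2$, being a harmonic map. The energy density is $\tfrac12|\nabla\sigma|^2$. *)

(* Defs.v *)
From HB Require Import structures.
From mathcomp Require Import all_boot all_order all_algebra.
From mathcomp Require Import all_classical all_reals all_analysis.

Set Implicit Arguments.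
Unset Strict Implicit.
Unset Printing Implicit Defensive.

Import Order.TTheory GRing.Theory Num.Theory.
Import numFieldNormedType.Exports.

Local Open Scope classical_set_scope.
Local Open Scope ring_scope.
Local Open Scope quotient_scope.

(* The library norm on 'rV[R]_3 is the sup norm: it is used only through the
   topology it induces, and lengths are always computed from [dot]. *)
Definition dot (R : realType) (u w : 'rV[R]_3) : R := \sum_i u 0 i * w 0 i.

Definition sphere2 (R : realType) : set 'rV[R]_3 := [set u | dot u u = 1].

(* The vectors xi_1, xi_2, xi_3 of the text are [xi 0], [xi 1], [xi 2]. *)
Definition right_handed_orthonormal (R : realType) (xi : 'I_3 -> 'rV[R]_3) :
    Prop :=
  (forall i j, dot (xi i) (xi j) = (i == j)%:R) /\
  0 < \det (\matrix_(i < 3) xi i).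

Definition axis (R : realType) (xi : 'I_3 -> 'rV[R]_3) : set 'rV[R]_3 :=
  [set t *: xi 2 | t in [set: R]].

Definition cyl_r (R : realType) (xi : 'I_3 -> 'rV[R]_3) (X : 'rV[R]_3) : R :=
  Num.sqrt (dot X (xi 0) ^+ 2 + dot X (xi 1) ^+ 2).

(* Principal determination of the polar angle, in ]-pi, pi]; it is meaningful
   off the axis only.  The choice is immaterial, since only the cosine and the
   sine of translates of the angle are used. *)
Definition cyl_theta (R : realType) (xi : 'I_3 -> 'rV[R]_3) (X : 'rV[R]_3) : R :=
  let a := acos (dot X (xi 0) / cyl_r xi X) in
  if 0 <= dot X (xi 1) then a else - a.

Definition e3 (R : realType) (i : 'I_3) : 'rV[R]_3 := delta_mx 0 i.

Definition iter_partial (R : realType) (s : seq 'I_3)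
    (f : 'rV[R]_3 -> 'rV[R]_3) : 'rV[R]_3 -> 'rV[R]_3 :=
  foldr (fun i g => 'D_(e3 R i) g) f s.

(* C^infinity on the (open) set U: partial derivatives of all orders exist and
   are continuous at every point of U. *)
Definition smooth_on (R : realType) (U : set 'rV[R]_3)
    (f : 'rV[R]_3 -> 'rV[R]_3) : Prop :=
  forall (s : seq 'I_3) (X : 'rV[R]_3), U X ->
    {for X, continuous (iter_partial s f)} /\
    forall i : 'I_3, derivable (iter_partial s f) X (e3 R i).

(* |nabla f|^2 *)
Definition bending (R : realType) (f : 'rV[R]_3 -> 'rV[R]_3) (X : 'rV[R]_3) : R :=
  \sum_(i < 3) dot ('D_(e3 R i) f X) ('D_(e3 R i) f X).

Definition energy_density (R : realType) (f : 'rV[R]_3 -> 'rV[R]_3)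
    (X : 'rV[R]_3) : R := 2^-1 * bending f X.

(* nabla^* nabla f = - Tr nabla^2 f, for the flat connection of R^3 *)
Definition rough_laplacian (R : realType) (f : 'rV[R]_3 -> 'rV[R]_3)
    (X : 'rV[R]_3) : 'rV[R]_3 :=
  - \sum_(i < 3) 'D_(e3 R i) ('D_(e3 R i) f) X.

Definition harmonic_unit_field_on (R : realType) (U : set 'rV[R]_3)
    (f : 'rV[R]_3 -> 'rV[R]_3) : Prop :=
  [/\ smooth_on U f,
      forall X, U X -> sphere2 (f X) &
      forall X, U X -> rough_laplacian f X = bending f X *: f X].

(* Functions ]0, +oo[ -> R are represented by total functions whose values
   outside ]0, +oo[ are irrelevant. *)
Definition smooth_pos (R : realType) (v : R -> R) : Prop :=
  forall (n : nat) (r : R), 0 < r -> derivable (derive1n n v) r 1.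

Definition is_profile (R : realType) (q : R) (v : R -> R) : Prop :=
  let V := fun r => 2 * v r in
  [/\ smooth_pos v,
      forall r, 0 < r -> r ^+ 2 * derive1n 2 V r + r * derive1 V r = sin (V r),
      v r @[r --> 0^'+] --> (0 : R) &
      derive1 v r @[r --> 0^'+] --> q].

(* sigma_{p,q}, where v stands for v_q; meaningful off the axis only. *)
Definition sigma (R : realType) (xi : 'I_3 -> 'rV[R]_3) (v : R -> R) (p : R)
    (X : 'rV[R]_3) : 'rV[R]_3 :=
  let r := cyl_r xi X in let theta := cyl_theta xi X in
  (cos (theta + p) * sin (v r)) *: xi 0 +
  (sin (theta + p) * sin (v r)) *: xi 1 +
  cos (v r) *: xi 2.

Definition glide (R : realType) (x : R * R) : R * R := (x.1 + pi, - x.2).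

(* y = glide^n x for some n in Z, i.e. x and y lie in the same orbit of the
   cyclic group generated by glide *)
Definition glide_orbit (R : realType) (x y : R * R) : Prop :=
  exists n : nat, y = iter n (@glide R) x \/ x = iter n (@glide R) y.

Lemma glide_inj (R : realType) : injective (@glide R).
Proof. by move=> [a b] [c d] [/addIr -> /oppr_inj ->]. Qed.

Lemma glide_orbit_equiv (R : realType) :
  equiv_class_of (fun x y : R * R => `[< glide_orbit x y >]).
Proof.
split.
- by move=> x; apply/asboolP; exists 0%N; left.
- by move=> x y; apply: asbool_equiv_eq; split=> -[n [->|->]]; exists n; auto.
- have iI n : injective (iter n (@glide R)).
    by elim: n => [//|n IHn] x y /= /glide_inj/IHn.
  move=> y x z /asboolP[n Hn] /asboolP[m Hm]; apply/asboolP.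
  case: Hn Hm => [->|->] [->|Hm].
  + by exists (m + n)%N; left; rewrite iterD.
  + have [le_mn|/ltnW le_nm] := leqP m n.
      exists (n - m)%N; left; apply: (iI m).
      by rewrite -Hm -iterD subnKC.
    exists (m - n)%N; right; apply: (iI n).
    by rewrite Hm -iterD subnKC.
  + have [le_mn|/ltnW le_nm] := leqP m n.
      exists (n - m)%N; right.
      by rewrite -iterD subnK.
    exists (m - n)%N; left.
    by rewrite -iterD subnK.
  + by exists (n + m)%N; right; rewrite Hm iterD.
Qed.

Definition glide_equiv (R : realType) : equiv_rel (R * R)%type :=
  EquivRelPack (glide_orbit_equiv R).

(* The open Moebius band R^2 / <glide>, with the quotient topology. *)
Definition moebius_band (R : realType) : topologicalType :=
  quotient_topology {eq_quot (glide_equiv R)}.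

Definition moebius_pi (R : realType) (x : R * R) : moebius_band R :=
  \pi_(quotient_topology {eq_quot (glide_equiv R)}) x.

(* Main.v *)
Require Import Defs.
From HB Require Import structures.
From mathcomp Require Import all_boot all_order all_algebra.
From mathcomp Require Import all_classical all_reals all_analysis.
From mathcomp Require Import ring lra.
Import Order.TTheory GRing.Theory Num.Theory.
Import numFieldNormedType.Exports.
Local Open Scope classical_set_scope.
Local Open Scope ring_scope.

(** In the variable log r the equation for V = 2 v is the pendulum equation, and
the solutions leaving the equilibrium V = 0 are the separatrices: this gives the
closed form v_q(r) = 2 atan (q r / 2) ([profile]).  It is the only solution
([is_profile_unique]): if v, w are two solutions with the same data at 0, put
d = v - w and e = r (v' - w').  Since sin is 1-Lipschitz, the system
r d' = e, r e' = (sin 2v - sin 2w) / 2 shows that (d^2 + e^2) / r^2 is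
nonincreasing.  By l'Hopital's rule d / r tends to 0 at 0+, and so does
e / r = v' - w'; hence d = 0.

With c = q / 2, the half-angle formulas turn sigma_{p,q} into inverse
stereographic projection of the complex linear map of slope c exp(i p), applied
to the projection along the axis ([sigma_profile]).  Writing a, b for the
coordinates along xi_1, xi_2 and u = 1 / (1 + c^2 (a^2 + b^2)), it is

  u (2c (a cos p - b sin p) xi_1 + 2c (a sin p + b cos p) xi_2 + 2 xi_3) - xi_3.

The denominator never vanishes, so the formula defines a smooth field on the
whole space ([rational_field_smooth]), equal to xi_3 on the axis.  As the
composite of the orthogonal projection to a plane with a conformal (or, for
c = 0, constant) map of that plane to the sphere it is harmonic
([stereo_field_laplacian]), with |nabla sigma|^2 = 8 c^2 u^2
([stereo_field_bending]), which is continuous and at most 8 c^2.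

Replacing (p, q) by (p + pi, - q) changes neither c exp(i p) nor c^2.  The
formula thus descends to the Moebius band, and continuously in (p, q)
([moebius_family_continuous]). *)

Set Implicit Arguments.
Unset Strict Implicit.
Unset Printing Implicit Defensive.

(** * Directional derivatives and rational functions *)

Lemma near_eq_continuous_at (S T : topologicalType) (f g : S -> T) (x : S) :
  (\near x, f x = g x) -> {for x, continuous f} -> {for x, continuous g}.
Proof.
move=> fg cf; rewrite /prop_for /continuous_at -(nbhs_singleton fg).
by apply: cvg_trans cf; apply: near_eq_cvg.
Qed.

Section calculus.
Context {R : realType} {V : normedModType R}.
Implicit Types (f g : V -> R) (x e : V).

Lemma is_derive_add f g x e df dg :
  is_derive x e f df -> is_derive x e g dg ->
  is_derive x e (fun y => f y + g y) (df + dg).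
Proof. by move=> fd gd; exact: is_deriveD. Qed.

Lemma is_derive_mul f g x e df dg :
  is_derive x e f df -> is_derive x e g dg ->
  is_derive x e (fun y => f y * g y) (f x * dg + df * g x).
Proof.
move=> fd gd; have := is_deriveM fd gd.
by rewrite (mulrC df).
Qed.

Lemma is_derive_inv f x e df : f x != 0 -> is_derive x e f df ->
  is_derive x e (fun y => (f y)^-1) (- (f x)^-1 ^+ 2 * df).
Proof.
move=> fx0 [fd <-]; apply: DeriveDef; first exact: derivableV.
by rewrite deriveV// exprVn.
Qed.

Lemma is_derive_scale (W : normedModType R) (w : W) f x e df :
  is_derive x e f df -> is_derive x e (fun y => f y *: w) (df *: w).
Proof.
move=> [fd <-].
have H : (fun h => h^-1 *: (((fun y => f y *: w) \o shift x) (h *: e) - f x *: w))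
    @ 0^' --> 'D_e f x *: w.
  rewrite (_ : (fun h => _) =
    (fun h => (h^-1 *: ((f \o shift x) (h *: e) - f x)) *: w)).
    exact: cvgZr_tmp.
  by apply/funext => h /=; rewrite -scalerBl scalerA.
apply: DeriveDef; last exact: cvg_lim H.
by apply/cvg_ex; eexists; exact: H.
Qed.

Lemma continuous_comb3 (T : topologicalType) (W : normedModType R)
    (w0 w1 w2 : W) (f0 f1 f2 : T -> R) :
  continuous f0 -> continuous f1 -> continuous f2 ->
  continuous (fun y => f0 y *: w0 + f1 y *: w1 + f2 y *: w2).
Proof.
move=> c0 c1 c2 x; apply: cvgD; [apply: cvgD|]; apply: cvgZr_tmp;
  [exact: c0|exact: c1|exact: c2].
Qed.

(** The identity of the line and the coordinate forms of the space are both
continuous and [linear_along]; they are the atoms of [rational_function]. *)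
Definition linear_along f := forall x e h, f (h *: e + x) = h * f e + f x.

Lemma is_derive_linear f x e : linear_along f -> is_derive x e f (f e).
Proof.
move=> fl.
have H : (fun h => h^-1 *: ((f \o shift x) (h *: e) - f x)) @ 0^' --> f e.
  apply: cvg_near_cst; near=> h => /=.
  rewrite fl addrK scalerA mulVf ?scale1r//.
  by near: h; exact: nbhs_dnbhs_neq.
apply: DeriveDef; last exact: cvg_lim H.
by apply/cvg_ex; eexists; exact: H.
Unshelve. all: by end_near. Qed.

(** A class of functions closed under every directional derivative: this closure
yields derivatives of all orders by a plain induction.  The side condition on
inverses keeps its members defined and continuous everywhere. *)
Inductive rational_function : (V -> R) -> Prop :=
| rational_cst k : rational_function (fun=> k)
| rational_linear f : continuous f -> linear_along f -> rational_function f
| rational_add f g : rational_function f -> rational_function g ->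
    rational_function (fun x => f x + g x)
| rational_mul f g : rational_function f -> rational_function g ->
    rational_function (fun x => f x * g x)
| rational_inv f : rational_function f -> (forall x, f x != 0) ->
    rational_function (fun x => (f x)^-1).

Lemma rational_continuous f : rational_function f -> continuous f.
Proof.
elim=> {f} [k||f g _ cf _ cg|f g _ cf _ cg|f _ cf f0]//= x.
- exact: cvg_cst.
- by apply: cvgD; [exact: cf|exact: cg].
- by apply: cvgM; [exact: cf|exact: cg].
- by apply: cvgV => //; exact: cf.
Qed.

Lemma rational_derive f e : rational_function f ->
  exists2 df, rational_function df & forall x, is_derive x e f (df x).
Proof.
elim=> {f} [k|f _ fl|f g rf [df rdf fd] rg [dg rdg gd]
           |f g rf [df rdf fd] rg [dg rdg gd]|f rf [df rdf fd] f0].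
- by exists (fun=> 0); [exact: rational_cst|move=> x; exact: is_derive_cst].
- exists (fun=> f e); first exact: rational_cst.
  by move=> x; exact: is_derive_linear.
- exists (fun x => df x + dg x); first exact: rational_add.
  by move=> x; exact: is_derive_add.
- exists (fun x => f x * dg x + df x * g x).
    by apply: rational_add; exact: rational_mul.
  by move=> x; exact: is_derive_mul.
- exists (fun x => -1 * ((f x)^-1 * (f x)^-1) * df x); last first.
    move=> x; have := @is_derive_inv f x e (df x) (f0 x) (fd x).
    by rewrite expr2 mulN1r.
  apply: rational_mul rdf; apply: rational_mul; first exact: rational_cst.
  by apply: rational_mul; exact: rational_inv.
Qed.

End calculus.

(** * The profile equation *)

Section profile.
Context {R : realType}.
Implicit Types (q c r s t : R) (v w : R -> R).

Local Notation rational_function := (@rational_function R R^o).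

Definition profile q r : R := 2 * atan (q / 2 * r).

Lemma sqr1D_gt0 t : 0 < 1 + t ^+ 2.
Proof. by rewrite ltr_pwDl ?ltr01 ?sqr_ge0. Qed.

Lemma cos2_atan t : cos (atan t) ^+ 2 = (1 + t ^+ 2)^-1.
Proof. by rewrite cos_atan exprVn sqr_sqrtr// ltW// sqr1D_gt0. Qed.

Lemma sin_atan t : sin (atan t) = t * cos (atan t).
Proof.
rewrite -[X in X * cos _](atanK t) /tan divfK// gt_eqF// cos_gt0_pihalf//.
by rewrite atan_gtNpi2 atan_ltpi2.
Qed.

Lemma sin_2atan t : sin (2 * atan t) = 2 * t / (1 + t ^+ 2).
Proof.
rewrite mulr_natl sin_mulr2n sin_atan -cos2_atan.
by ring.
Qed.

Lemma cos_2atan t : cos (2 * atan t) = (1 - t ^+ 2) / (1 + t ^+ 2).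
Proof.
by rewrite mulr_natl mulr2n cosD sin_atan -cos2_atan; ring.
Qed.

Lemma rational_id : rational_function (fun r : R => r).
Proof. by apply: (@rational_linear _ R^o) => x; [exact: cvg_id|move=> e h]. Qed.

Lemma rational_1Dsqr c : rational_function (fun r : R => 1 + (c * r) ^+ 2).
Proof.
apply: rational_add; first exact: rational_cst.
have H : rational_function (fun r : R => c * r).
  by apply: rational_mul; [exact: rational_cst|exact: rational_id].
exact: rational_mul.
Qed.

Lemma is_derive_profile q r :
  is_derive r 1 (profile q) (q / (1 + (q / 2 * r) ^+ 2)).
Proof.
have d1 : is_derive r 1 (fun r : R => q / 2 * r) (q / 2).
  by have := is_derive_mul (is_derive_cst (q / 2) r (1 : R))
    (is_derive_id r (1 : R)); rewrite mulr1 mul0r addr0.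
have d2 := is_derive1_comp (is_derive1_atan (q / 2 * r)) d1.
have := is_derive_mul (is_derive_cst (2 : R) r (1 : R)) d2.
rewrite mul0r addr0 /cst => H; apply: is_derive_eq H _.
by rewrite mulrCA [RHS]mulrC; congr (_ * _); field.
Qed.

Lemma derive1_profile q :
  derive1 (profile q) = fun r => q / (1 + (q / 2 * r) ^+ 2).
Proof.
by apply/funext => r; rewrite derive1E (@derive_val _ _ _ _ _ _ _
  (is_derive_profile q r)).
Qed.

Lemma rational_derive1_profile q :
  rational_function (fun r : R => q / (1 + (q / 2 * r) ^+ 2)).
Proof.
apply: rational_mul; first exact: rational_cst.
by apply: rational_inv => [|r]; [exact: rational_1Dsqr|rewrite gt_eqF// sqr1D_gt0].
Qed.

Lemma rational_derive1n f n :
  rational_function f -> rational_function (derive1n n f : R -> R).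
Proof.
move=> rf; elim: n => // n /(@rational_derive _ R^o _ (1 : R))[g rg dg].
rewrite derive1nS; suff -> : derive1 (derive1n n f) = g by [].
by apply/funext => r; rewrite derive1E (@derive_val _ _ _ _ _ _ _ (dg r)).
Qed.

Lemma smooth_profile q : smooth_pos (profile q).
Proof.
move=> [|n] r _; first by have [] := is_derive_profile q r.
rewrite derive1Sn derive1_profile.
have /(@rational_derive _ R^o _ (1 : R))[g _ dg] :=
  rational_derive1n n (rational_derive1_profile q).
by have [] := dg r.
Qed.

(** The factor 1 + (q r / 2)^2 comes from sin (2 atan t) = 2t / (1 + t^2) and
cos (2 atan t) = (1 - t^2) / (1 + t^2), so both sides of the equation are
rational in r. *)
Lemma is_profile_profile q : is_profile q (profile q).
Proof.
have c0 r : 1 + (q / 2 * r) ^+ 2 != 0 by rewrite gt_eqF// sqr1D_gt0.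
have V1 r : is_derive r 1 (fun r : R => 2 * profile q r)
    (2 * q * (1 + (q / 2 * r) ^+ 2)^-1).
  have := is_derive_mul (is_derive_cst (2 : R) r (1 : R)) (is_derive_profile q r).
  by rewrite mul0r addr0 mulrA.
have V1E : derive1 (fun r : R => 2 * profile q r) =
    fun r => 2 * q * (1 + (q / 2 * r) ^+ 2)^-1.
  by apply/funext => r; rewrite derive1E (@derive_val _ _ _ _ _ _ _ (V1 r)).
split.
- exact: smooth_profile.
- move=> r r0.
  rewrite /derive1n /= V1E.
  have d0 : is_derive r 1 (fun r : R => q / 2 * r) (q / 2).
    by have := is_derive_mul (is_derive_cst (q / 2) r (1 : R))
      (is_derive_id r (1 : R)); rewrite mulr1 mul0r addr0.
  have d1 : is_derive r 1 (fun r : R => 1 + (q / 2 * r) ^+ 2)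
     (q ^+ 2 / 2 * r).
    have := is_derive_add (is_derive_cst (1 : R) r (1 : R)) (is_derive_mul d0 d0).
    by move=> H; apply: is_derive_eq H _; field.
  have := is_derive_mul (is_derive_cst (2 * q) r (1 : R))
    (is_derive_inv (f := fun r => 1 + (q / 2 * r) ^+ 2) (c0 r) d1).
  rewrite derive1E => -[_ ->].
  have -> : 2 * profile q r = (2 * atan (q / 2 * r)) *+ 2.
    by rewrite /profile mulr_natl.
  rewrite sin_mulr2n sin_2atan cos_2atan /cst.
  by field; rewrite gt_eqF// ltr_pwDl ?sqr_ge0.
- have p0 : profile q 0 = 0 by rewrite /profile mulr0 atan0 mulr0.
  rewrite -[X in _ --> X]p0; apply: cvg_at_right_filter.
  apply: differentiable_continuous; apply/derivable1_diffP.
  by have [] := is_derive_profile q 0.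
- have p0 : q / (1 + (q / 2 * 0) ^+ 2) = q.
    by rewrite mulr0 expr0n addr0 divr1.
  rewrite derive1_profile -[X in _ --> X]p0; apply: cvg_at_right_filter.
  exact: rational_continuous (rational_derive1_profile q) (0 : R).
Qed.

(** The equation as a first order system in v and r v'.  Only the values on the
positive half-line are known, so the derivatives of 2 v are compared with those
of v on a neighbourhood of r. *)
Lemma is_profile_flow q v r : is_profile q v -> 0 < r ->
  is_derive r 1 v (derive1 v r) /\
  is_derive r 1 (fun s => s * derive1 v s) (sin (2 * v r) / (2 * r)).
Proof.
move=> [sv ode _ _] r0.
have dv s : 0 < s -> is_derive s 1 v (derive1 v s).
  by move=> s0; rewrite derive1E; apply/derivableP; exact: (sv 0%N).
have ddv : is_derive r 1 (derive1 v) (derive1 (derive1 v) r).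
  by rewrite derive1E; apply/derivableP; exact: (sv 1%N).
have V1 s : 0 < s -> derive1 (fun r => 2 * v r) s = 2 * derive1 v s.
  move=> s0; rewrite derive1E.
  have := is_derive_mul (is_derive_cst (2 : R) s (1 : R)) (dv s s0).
  by rewrite mul0r addr0 => -[_ ->].
have V2 : derive1n 2 (fun r => 2 * v r) r = 2 * derive1 (derive1 v) r.
  rewrite /derive1n /= derive1E.
  have := is_derive_mul (is_derive_cst (2 : R) r (1 : R)) ddv.
  rewrite mul0r addr0 => -[_ <-]; apply: near_eq_derive.
  near=> s; rewrite /cst V1//.
  by near: s; exact: lt_nbhsr.
split; first exact: dv.
have := is_derive_mul (is_derive_id r (1 : R)) ddv.
move=> H; apply: is_derive_eq H _.
have := ode r r0; rewrite V2 V1// => <-.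
by field; rewrite gt_eqF.
Unshelve. all: by end_near. Qed.

(** Both data at 0+ enter here: v(0+) = 0 allows l'Hopital's rule, and v'(0+) = q
gives the limit. *)
Lemma is_profile_slope q v : is_profile q v -> v r / r @[r --> 0^'+] --> q.
Proof.
move=> pv; have [_ _ v0 dv0] := pv.
apply: (@lhopital_at_right R v (derive1 v) id (fun=> 1) 0 1 q) => //.
- by move=> r; rewrite in_itv /= => /andP[r0 _]; have [] := is_profile_flow pv r0.
- exact: cvg_at_right_filter.
- apply: cvg_trans dv0; apply: near_eq_cvg; near=> r.
  by rewrite divr1.
Unshelve. all: by end_near. Qed.

Lemma sin_dist_le (a b : R) : `|sin a - sin b| <= `|a - b|.
Proof.
wlog ab : a b / a < b.
  move=> H; have [/H//|/H|->] := ltgtP a b; last by rewrite !subrr.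
  by rewrite distrC (distrC b).
have [|c _ E] := @MVT R sin cos a b ab (fun x _ => is_derive_sin x).
  by apply: continuous_subspaceT => x; exact: continuous_sin.
rewrite distrC E (distrC a) normrM ler_piMl//.
by rewrite ler_norml cos_geN1 cos_le1.
Qed.

Lemma nonincreasing_le0 (f df : R -> R) :
  (forall r, 0 < r -> is_derive r 1 f (df r)) ->
  (forall r, 0 < r -> df r <= 0) ->
  f r @[r --> 0^'+] --> (0 : R) -> forall r, 0 < r -> f r <= 0.
Proof.
move=> fd dle0 f0 r r0.
suff : f r <= lim (f x @[x --> 0^'+]) by rewrite (cvg_lim _ f0).
apply: limr_ge; first by apply/cvg_ex; exists 0.
near=> x.
have x0 : 0 < x by [].
have xr : x <= r by near: x; exact: nbhs_right_le.
apply: (@ler0_derive1_nincr R f x r) => //.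
- by move=> y; rewrite in_itv/= => /andP[xy _]; have [] := fd y (lt_trans x0 xy).
- move=> y; rewrite in_itv/= => /andP[xy _].
  by rewrite derive1E; have [_ ->] := fd y (lt_trans x0 xy);
    exact/dle0/(lt_trans x0).
- apply: derivable_within_continuous => y; rewrite in_itv/= => /andP[xy _].
  by have [] := fd y (lt_le_trans x0 xy).
Unshelve. all: by end_near. Qed.

(** The Lyapunov quantity (d^2 + e^2) / r^2 is nonincreasing because its
derivative is 2 r^-3 (d e + e (r e') - d^2 - e^2), where |r e'| <= |d|.  Any
weight r^-m with m >= 2 makes it nonincreasing, and m = 2 is the one for which
the conditions at 0+ give the limit 0. *)
Lemma is_profile_unique q v w : is_profile q v -> is_profile q w ->
  forall r, 0 < r -> v r = w r.
Proof.
move=> pv pw.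
pose d r := v r - w r; pose e r := r * derive1 v r - r * derive1 w r.
pose f r := (d r * d r + e r * e r) * (r^-1 * r^-1).
pose de r := sin (2 * v r) / (2 * r) - sin (2 * w r) / (2 * r).
pose df r :=
  2 * (r^-1 ^+ 3) * (d r * e r + e r * (r * de r) - (d r ^+ 2 + e r ^+ 2)).
have fd r : 0 < r -> is_derive r 1 f (df r).
  move=> r0.
  have [dv ev] := is_profile_flow pv r0; have [dw ew] := is_profile_flow pw r0.
  have dd : is_derive r 1 d (derive1 v r - derive1 w r) by exact: is_deriveB.
  have dde : is_derive r 1 e (de r) by exact: is_deriveB.
  have rn0 : r != 0 by rewrite gt_eqF.
  have di := is_derive_inv (f := id) rn0 (is_derive_id r (1 : R)).
  have := is_derive_mul (is_derive_add (is_derive_mul dd dd) (is_derive_mul dde dde))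
     (is_derive_mul di di).
  move=> H; apply: is_derive_eq H _.
  by rewrite /df /e; field.
have df0 r : 0 < r -> df r <= 0.
  move=> r0; rewrite /df; apply: mulr_ge0_le0.
    by rewrite mulr_ge0// exprn_ge0// invr_ge0 ltW.
  have : `|r * de r| <= `|d r|.
    have -> : r * de r = (sin (2 * v r) - sin (2 * w r)) / 2.
      by rewrite /de; field; rewrite gt_eqF.
    rewrite normrM normfV normr_nat ler_pdivrMr//.
    apply: le_trans (sin_dist_le _ _) _.
    by rewrite -mulrBr normrM normr_nat mulrC.
  move: (d r) (e r) (r * de r) => a b s.
  have : b * s <= `|b| * `|s| by rewrite -normrM ler_norm.
  have : a * b <= `|a| * `|b| by rewrite -normrM ler_norm.
  have := normr_ge0 a; have := normr_ge0 b; have := normr_ge0 s.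
  rewrite -(real_normK (num_real a)) -(real_normK (num_real b)).
  move: `|a| `|b| `|s| (a * b) (b * s) => A B S ab bs.
  by move=> S0 B0 A0 abAB bsBS SA;
  have := ler_wpM2l B0 SA; have := sqr_ge0 (A - B); nra.
have f0 : f r @[r --> 0^'+] --> (0 : R).
  have [_ _ _ v'] := pv; have [_ _ _ w'] := pw.
  have D : v r / r - w r / r @[r --> 0^'+] --> (0 : R).
    by rewrite -[X in _ --> X](subrr q); apply: cvgB;
      [exact: is_profile_slope pv|exact: is_profile_slope pw].
  have E : derive1 v r - derive1 w r @[r --> 0^'+] --> (0 : R).
    by rewrite -[X in _ --> X](subrr q); exact: cvgB.
  have DE : (v r / r - w r / r) * (v r / r - w r / r) +
      (derive1 v r - derive1 w r) * (derive1 v r - derive1 w r)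
      @[r --> 0^'+] --> (0 : R).
    rewrite -[X in _ --> X](addr0 (0 : R)) -[X in _ --> X + X](mulr0 (0 : R)).
    by apply: cvgD; apply: cvgM.
  apply: cvg_trans DE; apply: near_eq_cvg.
  near=> r; rewrite /f /d /e /=.
  by field; rewrite gt_eqF.
move=> r r0.
have := nonincreasing_le0 fd df0 f0 r0.
rewrite /f pmulr_lle0 ?mulr_gt0 ?invr_gt0// -!expr2 => H.
apply/eqP; rewrite -subr_eq0 -sqrf_eq0 eq_le sqr_ge0 andbT.
by apply: le_trans H; rewrite lerDl sqr_ge0.
Unshelve. all: by end_near. Qed.

End profile.

(** * Vector fields in an orthonormal frame *)

Section frame.
Context {R : realType}.
Implicit Types (u w X e : 'rV[R]_3) (xi : 'I_3 -> 'rV[R]_3).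

Lemma dotC u w : dot u w = dot w u.
Proof. by apply: eq_bigr => i _; rewrite mulrC. Qed.

Lemma dot_linear u w X (k : R) : dot (k *: u + w) X = k * dot u X + dot w X.
Proof.
rewrite /dot mulr_sumr -big_split /=; apply: eq_bigr => i _.
by rewrite !mxE mulrDl mulrA.
Qed.

Lemma dotDl u w X : dot (u + w) X = dot u X + dot w X.
Proof. by have := dot_linear u w X 1; rewrite scale1r mul1r. Qed.

Lemma dotZl (k : R) u X : dot (k *: u) X = k * dot u X.
Proof.
by rewrite /dot mulr_sumr; apply: eq_bigr => i _; rewrite !mxE mulrA.
Qed.

Lemma dot_e3 i w : dot (e3 R i) w = w 0 i.
Proof.
rewrite /dot (bigD1 i)//= big1 ?addr0; first by rewrite !mxE !eqxx mul1r.
by move=> j ji; rewrite !mxE eqxx (negbTE ji) mul0r.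
Qed.

(** Sums over the standard basis, in which the partial derivatives are taken, turn
into scalar products of the frame vectors. *)
Lemma dot_sum_e3 u w : \sum_i dot (e3 R i) u * dot (e3 R i) w = dot u w.
Proof. by apply: eq_bigr => i _; rewrite !dot_e3. Qed.

Lemma dot_continuous w : continuous (fun X => dot X w).
Proof.
apply: continuous_big => [|i _ X]; first exact: add_continuous.
apply: (@continuousM R _ (fun X : 'rV[R]_3 => X 0 i) (fun=> w 0 i)).
  exact: coord_continuous.
exact: cst_continuous.
Qed.

Lemma is_derive_dot w X e : is_derive X e (fun X => dot X w) (dot e w).
Proof.
apply: (is_derive_linear (f := fun X => dot X w)) => x d h.
exact: dot_linear.
Qed.

Lemma rational_dot w : rational_function (fun X : 'rV[R]_3 => dot X w).
Proof.
apply: rational_linear => [|x e h]; first exact: dot_continuous.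
exact: dot_linear.
Qed.

Definition axis_dist2 xi X : R := dot X (xi 0) ^+ 2 + dot X (xi 1) ^+ 2.

Lemma axis_dist2_ge0 xi X : 0 <= axis_dist2 xi X.
Proof. by rewrite addr_ge0 ?sqr_ge0. Qed.

Lemma rational_axis_dist2 xi : rational_function (axis_dist2 xi).
Proof.
have H i : rational_function (fun X => dot X (xi i) ^+ 2).
  exact: rational_mul (rational_dot (xi i)) (rational_dot (xi i)).
exact: rational_add.
Qed.

Definition frame_field xi (f0 f1 f2 : 'rV[R]_3 -> R) X : 'rV[R]_3 :=
  f0 X *: xi 0 + f1 X *: xi 1 + f2 X *: xi 2.

Lemma is_derive_frame_field xi f0 f1 f2 d0 d1 d2 X e :
  is_derive X e f0 d0 -> is_derive X e f1 d1 -> is_derive X e f2 d2 ->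
  is_derive X e (frame_field xi f0 f1 f2)
    (d0 *: xi 0 + d1 *: xi 1 + d2 *: xi 2).
Proof.
move=> df0 df1 df2.
by apply: is_deriveD; [apply: is_deriveD|]; exact: is_derive_scale.
Qed.

(** The rational coefficients make iterated partial derivatives of such a field
stay of the same form. *)
Definition rational_field xi (f : 'rV[R]_3 -> 'rV[R]_3) := exists f0 f1 f2,
  [/\ rational_function f0, rational_function f1, rational_function f2 &
      f = frame_field xi f0 f1 f2].

Lemma rational_field_derive xi f e : rational_field xi f ->
  rational_field xi ('D_e f) /\ forall X, derivable f X e.
Proof.
move=> [f0 [f1 [f2 [r0 r1 r2 ->]]]].
have [d0 rd0 h0] := rational_derive e r0; have [d1 rd1 h1] := rational_derive e r1.
have [d2 rd2 h2] := rational_derive e r2.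
have H X := is_derive_frame_field xi (h0 X) (h1 X) (h2 X).
split; last by move=> X; have [] := H X.
exists d0, d1, d2; split => //; apply/funext => X.
by have [_ ->] := H X.
Qed.

Lemma rational_field_continuous xi f : rational_field xi f -> continuous f.
Proof.
move=> [f0 [f1 [f2 [r0 r1 r2 ->]]]].
by apply: continuous_comb3; exact: rational_continuous.
Qed.

Lemma rational_field_smooth xi f U : rational_field xi f -> smooth_on U f.
Proof.
move=> rf s X _.
have {}rf : rational_field xi (iter_partial s f).
  by elim: s => // i s IH; have [] := rational_field_derive (e3 R i) IH.
split; first exact: rational_field_continuous rf X.
by move=> i; have [_] := rational_field_derive (e3 R i) rf.
Qed.

Lemma iter_partial_eq_in (U : set 'rV[R]_3) f g : open U ->
  (forall X, U X -> f X = g X) ->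
  forall s X, U X -> iter_partial s f X = iter_partial s g X.
Proof.
move=> oU fg; elim=> //= i s IH X UX; apply: near_eq_derive.
by near=> Y; apply: IH; near: Y; exact: open_nbhs_nbhs.
Unshelve. all: by end_near. Qed.

(** Derivatives at a point of an open set depend only on the values in that set;
this transports harmonicity from the globally defined fields to the fields given
by polar coordinates. *)
Lemma harmonic_unit_field_eq_in (U : set 'rV[R]_3) f g : open U ->
  (forall X, U X -> f X = g X) ->
  harmonic_unit_field_on U f -> harmonic_unit_field_on U g.
Proof.
move=> oU fg [sf uf hf].
have E := iter_partial_eq_in oU fg.
have nE s X : U X -> \near X, iter_partial s f X = iter_partial s g X.
  by move=> UX; near=> Y; apply: E; near: Y; exact: open_nbhs_nbhs.
split.
- move=> s X UX; have [cf df] := sf s X UX; split.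
    by apply: near_eq_continuous_at cf; exact: nE.
  by move=> i; apply: near_eq_derivable (df i); exact: nE.
- by move=> X UX; rewrite -fg//; exact: uf.
- move=> X UX; rewrite -fg//.
  have -> : rough_laplacian g X = rough_laplacian f X.
    rewrite /rough_laplacian; apply: f_equal; apply: eq_bigr => i _.
    exact: esym (E [:: i; i] X UX).
  have -> : bending g X = bending f X.
    apply: eq_bigr => i _.
    exact: (f_equal (fun d => dot d d) (esym (E [:: i] X UX))).
  exact: hf.
Unshelve. all: by end_near. Qed.

End frame.

Section orthonormal.
Context {R : realType}.
Variable xi : 'I_3 -> 'rV[R]_3.
Hypothesis xi_orth : forall i j, dot (xi i) (xi j) = (i == j)%:R.
Implicit Types X : 'rV[R]_3.

Lemma dot_frame_sum (x y z : R) :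
  let u := x *: xi 0 + y *: xi 1 + z *: xi 2 in
  [/\ dot u (xi 0) = x, dot u (xi 1) = y & dot u (xi 2) = z].
Proof.
by split; rewrite !dotDl !dotZl !xi_orth /= ?mulr1 ?mulr0 ?addr0 ?add0r.
Qed.

Lemma dot_frame_sqr (x y z : R) :
  let u := x *: xi 0 + y *: xi 1 + z *: xi 2 in
  dot u u = x ^+ 2 + y ^+ 2 + z ^+ 2.
Proof.
move=> u; have [ux uy uz] := dot_frame_sum x y z.
by rewrite {1}/u !dotDl !dotZl !(dotC _ u) ux uy uz !expr2.
Qed.

Lemma frame_expansion X :
  X = dot X (xi 0) *: xi 0 + dot X (xi 1) *: xi 1 + dot X (xi 2) *: xi 2.
Proof.
pose M := \matrix_i xi i.
have MM : M^T *m M = 1%:M.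
  apply: mulmx1C; apply/matrixP => i j; rewrite !mxE -xi_orth.
  by apply: eq_bigr => k _; rewrite !mxE.
rewrite -[LHS]mulmx1 -MM mulmxA mulmx_sum_row.
have E j : (X *m M^T) 0 j *: row j M = dot X (xi j) *: xi j.
  rewrite rowK; congr (_ *: _); rewrite mxE.
  by apply: eq_bigr => k _; rewrite !mxE.
under eq_bigr do rewrite E.
rewrite !big_ord_recl big_ord0 addr0 addrA.
by do !congr (_ + _); congr (dot _ (xi _) *: xi _); apply/val_inj.
Qed.

(** The converse implication uses that the frame spans the space. *)
Lemma axisE X : axis xi X <-> axis_dist2 xi X = 0.
Proof.
split=> [[t _ <-]|].
  by rewrite /axis_dist2 !dotZl !xi_orth /= !mulr0 !expr0n addr0.
move=> /eqP; rewrite paddr_eq0 ?sqr_ge0// !sqrf_eq0 => /andP[/eqP x0 /eqP y0].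
exists (dot X (xi 2)) => //.
by rewrite [RHS]frame_expansion x0 y0 !scale0r !add0r.
Qed.

Lemma open_setC_axis : open (~` axis xi).
Proof.
rewrite (_ : ~` _ = axis_dist2 xi @^-1` [set x | x != 0]); last first.
  by apply/seteqP; split => X /=; rewrite axisE => /eqP.
apply: open_comp; last exact: open_neq.
by move=> X _; apply: rational_continuous; exact: rational_axis_dist2.
Qed.

End orthonormal.

(** * The stereographic fields *)

Section stereographic.
Context {R : realType}.
Variable xi : 'I_3 -> 'rV[R]_3.
Implicit Types (X e : 'rV[R]_3) (p q c s t k r : R).

(** The factor 1 / (1 + |z|^2) of inverse stereographic projection, at the point z
of modulus c r; 4 c^2 times its square is the energy density of the field. *)
Definition conformal c X := (1 + c ^+ 2 * axis_dist2 xi X)^-1.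

(** All three components have this shape: the horizontal ones with k = 0, the
vertical one 2 u - 1 with s = t = 0 and k = -1.  Tying the constant of the affine
factor to the additive constant through - 2 k is what makes every such function
an eigenfunction of the Laplacian weighted by u^-2, hence allows a single
computation for the three of them. *)
Definition stereo_coord c s t k X : R :=
  conformal c X * (s * dot X (xi 0) + t * dot X (xi 1) - 2 * k) + k.

Definition stereo_field p c : 'rV[R]_3 -> 'rV[R]_3 :=
  frame_field xi (stereo_coord c (2 * c * cos p) (- (2 * c * sin p)) 0)
                 (stereo_coord c (2 * c * sin p) (2 * c * cos p) 0)
                 (stereo_coord c 0 0 (-1)).

Lemma conformal_den_gt0 c X : 0 < 1 + c ^+ 2 * axis_dist2 xi X.
Proof. by rewrite ltr_pwDl// mulr_ge0 ?sqr_ge0 ?axis_dist2_ge0. Qed.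

Lemma conformalK c X : conformal c X * (1 + c ^+ 2 * axis_dist2 xi X) = 1.
Proof. by rewrite mulVf// gt_eqF// conformal_den_gt0. Qed.

Lemma conformal_itv c X : 0 < conformal c X <= 1.
Proof.
rewrite invr_gt0 conformal_den_gt0 invf_le1 ?conformal_den_gt0//.
by rewrite lerDl mulr_ge0 ?sqr_ge0 ?axis_dist2_ge0.
Qed.

Lemma rational_conformal c : rational_function (conformal c).
Proof.
apply: rational_inv => [|X]; last by rewrite gt_eqF// conformal_den_gt0.
apply: rational_add; first exact: rational_cst.
by apply: rational_mul; [exact: rational_cst|exact: rational_axis_dist2].
Qed.

Lemma rational_stereo_coord c s t k : rational_function (stereo_coord c s t k).
Proof.
have H m i : rational_function (fun X => m * dot X (xi i)).
  by apply: rational_mul; [exact: rational_cst|exact: rational_dot].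
apply: rational_add; last exact: rational_cst.
apply: rational_mul; first exact: rational_conformal.
apply: rational_add; last exact: (rational_cst (- (2 * k))).
exact: rational_add.
Qed.

Lemma rational_stereo_field p c : rational_field xi (stereo_field p c).
Proof. by do 3 eexists; split; last reflexivity; exact: rational_stereo_coord. Qed.

Lemma is_derive_conformal c X e : is_derive X e (conformal c)
  (- (2 * c ^+ 2 * conformal c X ^+ 2 *
     (dot X (xi 0) * dot e (xi 0) + dot X (xi 1) * dot e (xi 1)))).
Proof.
have d0 := is_derive_dot (xi 0) X e; have d1 := is_derive_dot (xi 1) X e.
have dn0 : 1 + c ^+ 2 * axis_dist2 xi X != 0.
  by rewrite gt_eqF// conformal_den_gt0.
have dD := is_derive_add (is_derive_cst (1 : R) X e)
  (is_derive_mul (is_derive_cst (c ^+ 2) X e)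
    (is_derive_add (is_derive_mul d0 d0) (is_derive_mul d1 d1))).
have := is_derive_inv (f := fun X => 1 + c ^+ 2 * axis_dist2 xi X) dn0 dD.
by move=> H; apply: is_derive_eq H _; rewrite /conformal /cst; ring.
Qed.

Definition stereo_coord_deriv c s t k e X : R :=
  conformal c X * (s * dot e (xi 0) + t * dot e (xi 1))
  - 2 * c ^+ 2 * conformal c X ^+ 2 *
    (dot X (xi 0) * dot e (xi 0) + dot X (xi 1) * dot e (xi 1)) *
    (s * dot X (xi 0) + t * dot X (xi 1) - 2 * k).

Lemma is_derive_affine s t k X e :
  is_derive X e (fun X => s * dot X (xi 0) + t * dot X (xi 1) - 2 * k)
    (s * dot e (xi 0) + t * dot e (xi 1)).
Proof.
have d i m := is_derive_mul (is_derive_cst m X e) (is_derive_dot (xi i) X e).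
have := is_derive_add (is_derive_add (d 0 s) (d 1 t))
  (is_derive_cst (- (2 * k)) X e).
by move=> H; apply: is_derive_eq H _; rewrite /cst; ring.
Qed.

Lemma is_derive_stereo_coord c s t k X e :
  is_derive X e (stereo_coord c s t k) (stereo_coord_deriv c s t k e X).
Proof.
have := is_derive_add (is_derive_mul (is_derive_conformal c X e)
  (is_derive_affine s t k X e)) (is_derive_cst k X e).
by move=> H; apply: is_derive_eq H _; rewrite /stereo_coord_deriv /cst; ring.
Qed.

(** The second derivative is arranged as a quadratic form in the components of e
along the first two frame vectors, so that [trace_frame] gives its trace as the
sum of the two diagonal coefficients. *)
Lemma is_derive_stereo_coord_deriv c s t k X e :
  let a := dot X (xi 0) in let b := dot X (xi 1) in
  let u := conformal c X in let l := s * a + t * b - 2 * k in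
  is_derive X e (stereo_coord_deriv c s t k e)
    ((8 * c ^+ 4 * u ^+ 3 * a ^+ 2 * l - 4 * c ^+ 2 * u ^+ 2 * a * s
      - 2 * c ^+ 2 * u ^+ 2 * l) * (dot e (xi 0) * dot e (xi 0))
    + (16 * c ^+ 4 * u ^+ 3 * a * b * l - 4 * c ^+ 2 * u ^+ 2 * (a * t + b * s))
      * (dot e (xi 0) * dot e (xi 1))
    + (8 * c ^+ 4 * u ^+ 3 * b ^+ 2 * l - 4 * c ^+ 2 * u ^+ 2 * b * t
      - 2 * c ^+ 2 * u ^+ 2 * l) * (dot e (xi 1) * dot e (xi 1))).
Proof.
have du := is_derive_conformal c X e.
have da i := is_derive_mul (is_derive_dot (xi i) X e)
  (is_derive_cst (dot e (xi i)) X e).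
have := is_derive_add
  (is_derive_mul du (is_derive_cst (s * dot e (xi 0) + t * dot e (xi 1)) X e))
  (is_derive_mul (is_derive_cst (- 1 : R) X e)
  (is_derive_mul (is_derive_mul
    (is_derive_mul (is_derive_cst (2 * c ^+ 2) X e) (is_derive_mul du du))
    (is_derive_add (da 0) (da 1))) (is_derive_affine s t k X e))).
rewrite (_ : (fun Y => _) = stereo_coord_deriv c s t k e); last first.
  by apply/funext => Y; rewrite /stereo_coord_deriv /cst; ring.
move=> H; apply: is_derive_eq H _; rewrite /cst; ring.
Qed.

Hypothesis xi_orth : forall i j, dot (xi i) (xi j) = (i == j)%:R.

Lemma trace_frame (A B C : R) :
  \sum_i (A * (dot (e3 R i) (xi 0) * dot (e3 R i) (xi 0))
    + B * (dot (e3 R i) (xi 0) * dot (e3 R i) (xi 1))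
    + C * (dot (e3 R i) (xi 1) * dot (e3 R i) (xi 1))) = A + C.
Proof.
by rewrite !big_split /= -!mulr_sumr !dot_sum_e3 !xi_orth /= !mulr1 mulr0 addr0.
Qed.

Lemma derive_stereo_field p c e X : 'D_e (stereo_field p c) X = frame_field xi
  (stereo_coord_deriv c (2 * c * cos p) (- (2 * c * sin p)) 0 e)
  (stereo_coord_deriv c (2 * c * sin p) (2 * c * cos p) 0 e)
  (stereo_coord_deriv c 0 0 (-1) e) X.
Proof.
by have [_ ->] := is_derive_frame_field xi
  (is_derive_stereo_coord c (2 * c * cos p) (- (2 * c * sin p)) 0 X e)
  (is_derive_stereo_coord c (2 * c * sin p) (2 * c * cos p) 0 X e)
  (is_derive_stereo_coord c 0 0 (-1) X e).
Qed.

Lemma stereo_field_sphere p c X : sphere2 (stereo_field p c X).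
Proof.
rewrite /sphere2 /= /stereo_field /frame_field dot_frame_sqr// /stereo_coord.
have := conformalK c X; rewrite /axis_dist2.
have := cos2Dsin2 p.
move: (conformal c X) (dot X (xi 0)) (dot X (xi 1)) (cos p) (sin p) => u a b C S.
move=> CS uD.
have -> : (u * (2 * c * C * a + - (2 * c * S) * b - 2 * 0) + 0) ^+ 2 +
 (u * (2 * c * S * a + 2 * c * C * b - 2 * 0) + 0) ^+ 2 +
 (u * (0 * a + 0 * b - 2 * -1) - 1) ^+ 2 =
   4 * u * (u * (1 + c ^+ 2 * (a ^+ 2 + b ^+ 2) * (C ^+ 2 + S ^+ 2)) - 1) + 1.
  by ring.
by rewrite CS mulr1 uD subrr mulr0 add0r.
Qed.

(** Conformality: along each direction e, the squared length of the derivative is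
4 c^2 u^2 times that of the horizontal part of e. *)
Lemma stereo_field_bending p c X :
  bending (stereo_field p c) X = 8 * c ^+ 2 * conformal c X ^+ 2.
Proof.
rewrite /bending.
set A := 4 * c ^+ 2 * conformal c X ^+ 2.
have E e : dot ('D_e (stereo_field p c) X) ('D_e (stereo_field p c) X) =
    A * (dot e (xi 0) * dot e (xi 0)) + 0 * (dot e (xi 0) * dot e (xi 1))
    + A * (dot e (xi 1) * dot e (xi 1)).
  rewrite derive_stereo_field dot_frame_sqr// /stereo_coord_deriv /A.
  have := conformalK c X; rewrite /axis_dist2.
  have := cos2Dsin2 p.
  move: (conformal c X) (dot X (xi 0)) (dot X (xi 1)) (cos p) (sin p) => u a b C S.
  move: (dot e (xi 0)) (dot e (xi 1)) => x y CS uD.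
  set lhs := (X in X = _); set rhs := (X in _ = X).
  (* The difference of the sides is a combination of the two relations
     C^2 + S^2 = 1 and u (1 + c^2 (a^2 + b^2)) = 1. *)
  suff : lhs - rhs = 4 * c ^+ 2 * u ^+ 2 * (x ^+ 2 + y ^+ 2) * (C ^+ 2 + S ^+ 2 - 1)
     + 16 * c ^+ 4 * u ^+ 3 * (a * x + b * y) ^+ 2 *
       (u * (1 + c ^+ 2 * (a ^+ 2 + b ^+ 2)) - 1)
     + 16 * c ^+ 4 * u ^+ 3 * (a * x + b * y) ^+ 2 * (C ^+ 2 + S ^+ 2 - 1)
       * (c ^+ 2 * u * (a ^+ 2 + b ^+ 2) - 1).
    by rewrite CS uD !subrr !(mulr0, mul0r) !addr0 => /eqP; rewrite subr_eq0 => /eqP.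
  by rewrite /lhs /rhs; ring.
rewrite (eq_bigr _ (fun i _ => E (e3 R i))) trace_frame.
by rewrite /A; ring.
Qed.

(** Each coordinate f in the frame satisfies Delta f = - 8 c^2 u^2 f. *)
Lemma stereo_field_laplacian p c X :
  rough_laplacian (stereo_field p c) X =
  (8 * c ^+ 2 * conformal c X ^+ 2) *: stereo_field p c X.
Proof.
pose a := dot X (xi 0); pose b := dot X (xi 1); pose u := conformal c X.
pose A s t k := 8 * c ^+ 4 * u ^+ 3 * a ^+ 2 * (s * a + t * b - 2 * k)
  - 4 * c ^+ 2 * u ^+ 2 * a * s - 2 * c ^+ 2 * u ^+ 2 * (s * a + t * b - 2 * k).
pose B s t k := 16 * c ^+ 4 * u ^+ 3 * a * b * (s * a + t * b - 2 * k)
  - 4 * c ^+ 2 * u ^+ 2 * (a * t + b * s).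
pose C s t k := 8 * c ^+ 4 * u ^+ 3 * b ^+ 2 * (s * a + t * b - 2 * k)
  - 4 * c ^+ 2 * u ^+ 2 * b * t - 2 * c ^+ 2 * u ^+ 2 * (s * a + t * b - 2 * k).
pose H s t k e := A s t k * (dot e (xi 0) * dot e (xi 0))
  + B s t k * (dot e (xi 0) * dot e (xi 1))
  + C s t k * (dot e (xi 1) * dot e (xi 1)).
have dH s t k e : is_derive X e (stereo_coord_deriv c s t k e) (H s t k e).
  exact: is_derive_stereo_coord_deriv.
have AC s t k : A s t k + C s t k = - (8 * c ^+ 2 * u ^+ 2) * stereo_coord c s t k X.
  have := conformalK c X; rewrite /axis_dist2 /A /C /stereo_coord -/a -/b -/u => uD.
  set lhs := (X in X = _); set rhs := (X in _ = X).
  suff : lhs - rhs = 8 * c ^+ 2 * u ^+ 2 * (s * a + t * b - 2 * k) *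
    (u * (1 + c ^+ 2 * (a ^+ 2 + b ^+ 2)) - 1).
    by rewrite uD subrr mulr0 => /eqP; rewrite subr_eq0 => /eqP.
  by rewrite /lhs /rhs; ring.
have E e : 'D_e ('D_e (stereo_field p c)) X =
    H (2 * c * cos p) (- (2 * c * sin p)) 0 e *: xi 0 +
    H (2 * c * sin p) (2 * c * cos p) 0 e *: xi 1 + H 0 0 (-1) e *: xi 2.
  under eq_fun do rewrite derive_stereo_field.
  by have [_ ->] := is_derive_frame_field xi
    (dH (2 * c * cos p) (- (2 * c * sin p)) 0 e)
    (dH (2 * c * sin p) (2 * c * cos p) 0 e) (dH 0 0 (-1) e).
rewrite /rough_laplacian (eq_bigr _ (fun i _ => E (e3 R i))).
rewrite !big_split /= -!scaler_suml !trace_frame !AC.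
by rewrite !mulNr !scaleNr !opprD !opprK /stereo_field /frame_field
  !scalerDr !scalerA.
Qed.

Lemma harmonic_stereo_field p c U : harmonic_unit_field_on U (stereo_field p c).
Proof.
split.
- exact: rational_field_smooth (rational_stereo_field p c).
- by move=> X _; exact: stereo_field_sphere.
- by move=> X _; rewrite stereo_field_laplacian stereo_field_bending.
Qed.

Lemma stereo_field_axis p c X : axis xi X -> stereo_field p c X = xi 2.
Proof.
move=> [z _ <-]; rewrite /stereo_field /frame_field /stereo_coord /conformal.
have E0 : dot (z *: xi 2) (xi 0) = 0 by rewrite dotZl xi_orth mulr0.
have E1 : dot (z *: xi 2) (xi 1) = 0 by rewrite dotZl xi_orth mulr0.
rewrite /axis_dist2 E0 E1 !(mulr0, expr0n, oppr0, addr0, scale0r, add0r).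
by rewrite (_ : 1^-1 * _ - 1 = 1 :> R) ?scale1r//; field.
Qed.

End stereographic.

(** * Cylindrical coordinates *)

Section cylindrical.
Context {R : realType}.
Variable xi : 'I_3 -> 'rV[R]_3.
Implicit Types (X : 'rV[R]_3) (p q c : R).

Lemma sqr_cyl_r X : cyl_r xi X ^+ 2 = axis_dist2 xi X.
Proof. by rewrite sqr_sqrtr// axis_dist2_ge0. Qed.

(** The choice between the arc cosine and its opposite restores the sign of the
sine, which acos forgets. *)
Lemma cyl_thetaP X : 0 < cyl_r xi X ->
  cos (cyl_theta xi X) = dot X (xi 0) / cyl_r xi X /\
  sin (cyl_theta xi X) = dot X (xi 1) / cyl_r xi X.
Proof.
move=> r0; have r2 := sqr_cyl_r X.
set a := dot X (xi 0); set b := dot X (xi 1); set r := cyl_r xi X in r0 r2 *.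
have r2E : r ^+ 2 = a ^+ 2 + b ^+ 2 by [].
have I : -1 <= a / r <= 1.
  rewrite -ler_norml normrM normfV (gtr0_norm r0) ler_pdivrMr// mul1r.
  rewrite -(ler_pXn2r (n := 2)) ?nnegrE// ?(ltW r0)//.
  by rewrite real_normK ?num_real// r2E lerDl sqr_ge0.
have S : sin (acos (a / r)) = `|b| / r.
  rewrite sin_acos// (_ : 1 - _ = (b / r) ^+ 2).
    by rewrite sqrtr_sqr normrM normfV (gtr0_norm r0).
  have rn0 : r ^+ 2 != 0 by rewrite expf_neq0// gt_eqF.
  by rewrite !expr_div_n -[X in X - _](divff rn0) -mulrBl r2E addrAC subrr add0r.
rewrite /cyl_theta -/a -/b -/r; case: ifPn => [b0|]; last rewrite -ltNge => b0.
  by rewrite acosK ?in_itv//= S ger0_norm.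
by rewrite cosN sinN acosK ?in_itv//= S ltr0_norm// mulNr opprK.
Qed.

(** The angle addition formulas absorb the phase p, and sin v and cos v are
2 c r / (1 + c^2 r^2) and (1 - c^2 r^2) / (1 + c^2 r^2); the factor r of sin v
cancels the denominators of cos theta and sin theta. *)
Lemma sigma_stereo_field p q v X : 0 < cyl_r xi X ->
  v (cyl_r xi X) = profile q (cyl_r xi X) ->
  sigma xi v p X = stereo_field xi p (q / 2) X.
Proof.
move=> r0 vE; have [C S] := cyl_thetaP r0.
rewrite /sigma vE /profile sin_2atan cos_2atan cosD sinD C S.
rewrite /stereo_field /frame_field /stereo_coord /conformal -sqr_cyl_r.
move: (cyl_r xi X) (dot X (xi 0)) (dot X (xi 1)) r0 => r a b r0.
have D := sqr1D_gt0 (q / 2 * r); rewrite -exprMn.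
by congr (_ *: _ + _ *: _ + _ *: _); field;
  rewrite ?gt_eqF// ?ltr_pwDl// sqr_ge0.
Qed.

Lemma stereo_field_glide p c : stereo_field xi (p + pi) (- c) = stereo_field xi p c.
Proof.
rewrite /stereo_field /stereo_coord /conformal cosDpi sinDpi sqrrN.
by rewrite !mulrN !mulNr !opprK.
Qed.

Hypothesis xi_orth : forall i j, dot (xi i) (xi j) = (i == j)%:R.

Lemma cyl_r_gt0 X : ~ axis xi X -> 0 < cyl_r xi X.
Proof.
move=> nX; rewrite sqrtr_gt0 lt0r axis_dist2_ge0 andbT.
by apply/eqP => /axisE -/(_ xi_orth)/nX.
Qed.

Lemma sigma_profile p q v X : is_profile q v -> ~ axis xi X ->
  sigma xi v p X = stereo_field xi p (q / 2) X.
Proof.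
move=> pv /cyl_r_gt0 r0; apply: sigma_stereo_field => //.
exact: is_profile_unique pv (is_profile_profile q) _ r0.
Qed.

End cylindrical.

(** * The family over the Moebius band *)

Section moebius.
Context {R : realType}.
Variable xi : 'I_3 -> 'rV[R]_3.
Implicit Types (X : 'rV[R]_3) (x y : R * R).

Definition stereo_family X x := stereo_field xi x.1 (x.2 / 2) X.

Lemma stereo_family_continuous X : continuous (stereo_family X).
Proof.
have c1 : continuous (fun x : R * R => x.1) by move=> x; exact: cvg_fst.
have c2 : continuous (fun x : R * R => x.2 / 2).
  by move=> x; apply: cvgM; [exact: cvg_snd|exact: cvg_cst].
have cM (f g : R * R -> R) : continuous f -> continuous g ->
    continuous (fun x => f x * g x).
  by move=> cf cg x; apply: cvgM; [exact: cf|exact: cg].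
have cD (f g : R * R -> R) : continuous f -> continuous g ->
    continuous (fun x => f x + g x).
  by move=> cf cg x; apply: cvgD; [exact: cf|exact: cg].
have cN (f : R * R -> R) : continuous f -> continuous (fun x => - f x).
  by move=> cf x; apply: cvgN; exact: cf.
have cC (k : R) : continuous (fun _ : R * R => k) by move=> x; exact: cvg_cst.
have cu : continuous (fun x : R * R => conformal xi (x.2 / 2) X).
  move=> x; apply: cvgV; first by rewrite gt_eqF// conformal_den_gt0.
  by apply: (cD); [exact: (cC)|apply: (cM) => //; exact: (cM)].
have ccos : continuous (fun x : R * R => cos x.1).
  by move=> x; apply: continuous_comp; [exact: c1|exact: continuous_cos].
have csin : continuous (fun x : R * R => sin x.1).
  by move=> x; apply: continuous_comp; [exact: c1|exact: continuous_sin].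
have H (s t : R * R -> R) (k : R) : continuous s -> continuous t ->
    continuous (fun x => stereo_coord xi (x.2 / 2) (s x) (t x) k X).
  move=> cs ct; apply: (cD) => //; apply: (cM) => //; apply: (cD) => //.
  by apply: (cD); apply: (cM).
apply: continuous_comb3; apply: (H) => //.
- by apply: (cM) => //; apply: (cM).
- by apply: (cN); apply: (cM) => //; apply: (cM).
- by apply: (cM) => //; apply: (cM).
- by apply: (cM) => //; apply: (cM).
Qed.

Lemma stereo_family_glide X x y :
  glide_orbit x y -> stereo_family X x = stereo_family X y.
Proof.
have G n z : stereo_family X (iter n (@glide R) z) = stereo_family X z.
  by elim: n => //= n <-; rewrite /stereo_family /= mulNr stereo_field_glide.
by move=> [n [->|->]]; rewrite G.
Qed.

(** Values are computed on an arbitrary representative;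
[stereo_family_glide] makes them independent of it. *)
Definition moebius_family (m : moebius_band R) X := stereo_family X (repr m).

Lemma moebius_pi_eqP x y : moebius_pi x = moebius_pi y -> glide_orbit x y.
Proof. by move=> /eqquotP/asboolP. Qed.

Lemma moebius_family_pi x X : moebius_family (moebius_pi x) X = stereo_family X x.
Proof.
apply: stereo_family_glide; apply: moebius_pi_eqP.
exact: reprK.
Qed.

Lemma moebius_family_continuous X :
  continuous (fun m : moebius_band R => moebius_family m X).
Proof.
apply: (repr_comp_continuous (@stereo_family_continuous X))
  => x y /eqP/moebius_pi_eqP xy.
by apply/eqP; exact: stereo_family_glide.
Qed.

End moebius.

(** * The harmonic fields *)

Theorem mainTheorem5 (R : realType) (xi : 'I_3 -> 'rV[R]_3)
    (hxi : right_handed_orthonormal xi) :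
  (forall q : R,
     (exists v : R -> R, is_profile q v) /\
     (forall v w : R -> R, is_profile q v -> is_profile q w ->
        forall r : R, 0 < r -> v r = w r)) /\
  (forall v : R -> R -> R, (forall q : R, is_profile q (v q)) ->
     [/\ (* (a) *)
         forall p q : R,
           (exists F : 'rV[R]_3 -> 'rV[R]_3,
              [/\ continuous F,
                  forall X, sphere2 (F X),
                  forall X, ~ axis xi X -> F X = sigma xi (v q) p X &
                  forall X, axis xi X -> F X = xi 2]) /\
           harmonic_unit_field_on (~` axis xi) (sigma xi (v q) p),
         (* (b) *)
         forall p q : R,
           exists f : 'rV[R]_3 -> R,
             [/\ continuous f, bounded_fun f &
                 forall X, ~ axis xi X ->
                   f X = energy_density (sigma xi (v q) p) X],
         (* (c) *)
         forall (p q : R) (X : 'rV[R]_3), ~ axis xi X ->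
           sigma xi (v q) (p + pi) X = sigma xi (v (- q)) p X &
         exists Phi : moebius_band R -> 'rV[R]_3 -> 'rV[R]_3,
           (forall (p q : R) (X : 'rV[R]_3), ~ axis xi X ->
              Phi (moebius_pi (p, q)) X = sigma xi (v q) p X) /\
           (forall X : 'rV[R]_3, ~ axis xi X ->
              continuous (fun m : moebius_band R => Phi m X))]).
Proof.
have [xi_orth _] := hxi.
split=> [q|v pv].
  split; first by exists (profile q); exact: is_profile_profile.
  by move=> v w pv pw; exact: is_profile_unique pv pw.
have sigmaE p q X : (~` axis xi) X ->
    stereo_field xi p (q / 2) X = sigma xi (v q) p X.
  by move=> nX; rewrite (sigma_profile xi_orth _ (pv q) nX).
have oU := open_setC_axis xi_orth.
split.
- move=> p q; split.
    exists (stereo_field xi p (q / 2)); split.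
    + exact: rational_field_continuous (rational_stereo_field xi p (q / 2)).
    + exact: stereo_field_sphere.
    + exact: sigmaE.
    + exact: stereo_field_axis.
  apply: harmonic_unit_field_eq_in oU (sigmaE p q) _.
  exact: harmonic_stereo_field.
- move=> p q; exists (fun X =>
    q ^+ 2 * (conformal xi (q / 2) X * conformal xi (q / 2) X)).
  split.
  + apply: rational_continuous; apply: rational_mul; first exact: rational_cst.
    by apply: rational_mul; exact: rational_conformal.
  + exists (q ^+ 2); split; first exact: num_real.
    move=> M qM X _; apply: le_trans (ltW qM).
    have /andP[u0 u1] := conformal_itv xi (q / 2) X.
    have uu0 := mulr_ge0 (ltW u0) (ltW u0).
    rewrite ger0_norm; last by rewrite (mulr_ge0 (sqr_ge0 q)).
    by rewrite ler_piMr ?sqr_ge0// mulr_ile1// ltW.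
  + move=> X nX; rewrite /energy_density.
    have -> : bending (sigma xi (v q) p) X = bending (stereo_field xi p (q / 2)) X.
      apply: eq_bigr => i _; apply: (f_equal (fun d => dot d d)).
      exact: esym (iter_partial_eq_in oU (sigmaE p q) [:: i] nX).
    by rewrite stereo_field_bending//; field.
- move=> p q X nX; rewrite -!sigmaE// -[q in LHS]opprK.
  by rewrite mulNr stereo_field_glide mulNr.
- exists (moebius_family xi); split=> [p q X nX|X _].
    by rewrite moebius_family_pi -sigmaE.
  exact: moebius_family_continuous.
Qed.
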